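(* (a) Let $n\ge 1$ be an odd integer, let $t$ be an integer with $t\ge (n+3)/2$, and let $D(x)\in\mathbb{Z}[x]$ be a monic separable polynomial of degree $t-(n+3)/2$ with all roots (if any) in the open interval $(-2,2)$ and such that $\gcd(D,C_n)=1$. Then, for all sufficiently large integers $a$, the polynomial $$C_n(x)\,(x-2)\,D(x)\,(x-a)-1$$ is the trace polynomial (of degree $t$) of a Salem number $\alpha$ such that $\alpha^{n}-1$ is a unit. (b) Let $n\ge 2$ be an even integer, let $t$ be an odd integer with $t\ge (n+4)/2$, and let $D(x)\in\mathbb{Z}[x]$ be a monic separable polynomial of degree $t-(n+4)/2$ with all roots (if any) in $(-2,2)$ and such that $\gcd(D,C_n)=1$. Then, for all sufficiently large integers $a$, the polynomial $$C_n(x)\,(x^{2}-4)\,D(x)\,(x-a)-1$$ is the trace polynomial (of degree $t$) of a Salem number $\alpha$ such that $\alpha^{n}-1$ is a unit.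
   Context: A Salem number is a real algebraic integer greater than $1$ whose other conjugates (over $\mathbb{Q}$) all lie in the closed unit disc, with at least one conjugate on the unit circle. If $\alpha$ is a Salem number with minimal polynomial $S$ over $\mathbb{Q}$, then $\deg S=2t$ with $t\ge 2$, and the roots of $S$ are $\alpha_1^{\pm1},\dots,\alpha_t^{\pm 1}$, where $\alpha_1=\alpha$ and $\alpha_2^{\pm1},\dots,\alpha_t^{\pm1}$ lie on the unit circle. The trace polynomial of $\alpha$ is $$T(x)=\prod_{k=1}^{t}\bigl(x-(\alpha_k+\alpha_k^{-1})\bigr)\in\mathbb{Z}[x];$$ it satisfies $S(x)=x^{t}T(x+1/x)$. A unit is an algebraic integer whose inverse is also an algebraic integer. For an integer $n\ge 1$ put $$C_n(x)=\prod_{k=1}^{(n-1)/2}\Bigl(x-2\cos\frac{2k\pi}{n}\Bigr)\ \text{ if } n \text{ is odd},\qquad C_n(x)=\prod_{k=1}^{(n-2)/2}\Bigl(x-2\cos\frac{2k\pi}{n}\Bigr)\ \text{ if } n \text{ is even}.$$ An empty product equals $1$, so $C_1=C_2=1$. One has $C_n\in\mathbb{Z}[x]$. *)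

(* Defs.v *)
From mathcomp Require Import all_boot all_order all_algebra all_field.
From mathcomp Require Import reals trigo.
From mathcomp Require Import complex.

Set Implicit Arguments.
Unset Strict Implicit.
Unset Printing Implicit Defensive.

Import Order.TTheory GRing.Theory Num.Theory.

Local Open Scope ring_scope.
Local Open Scope complex_scope.

Definition alg_int (F : fieldType) (x : F) : Prop :=
  integralOver (intr : int -> F) x.

Definition alg_unit (F : fieldType) (x : F) : Prop :=
  [/\ x != 0, alg_int x & alg_int x^-1].

(* The monic polynomial of least degree over the rationals vanishing at x
   (F is meant to have characteristic 0). *)
Definition is_minpoly (F : fieldType) (S : {poly rat}) (x : F) : Prop :=
  [/\ S \is monic,
      root (map_poly ratr S) x &
      forall q : {poly rat}, q != 0 -> root (map_poly ratr q) x ->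
        (size S <= size q)%N].

Definition conjugate (R : realType) (x : R) (z : R[i]) : Prop :=
  exists2 S : {poly rat}, is_minpoly S x & root (map_poly ratr S) z.

Definition salem (R : realType) (alpha : R) : Prop :=
  [/\ alg_int alpha,
      1 < alpha,
      forall z : R[i], conjugate alpha z -> z != alpha%:C -> `|z| <= 1 &
      exists2 z : R[i], conjugate alpha z & `|z| = 1].

(* The minimal polynomial S of alpha has, with multiplicity, the roots
   a 1, (a 1)^-1, ..., a t, (a t)^-1 with a 1 = alpha and the others on the unit
   circle; only the values a 1, ..., a t matter, and T does not depend on
   which member of each pair is called a k. *)
Definition is_trace_poly (R : realType) (alpha : R) (T : {poly R}) : Prop :=
  exists (S : {poly rat}) (t : nat) (a : nat -> R[i]),
    [/\ is_minpoly S alpha,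
        (2 <= t)%N /\ a 1%N = alpha%:C,
        forall k : nat, (2 <= k <= t)%N -> `|a k| = 1,
        map_poly ratr S =
          \prod_(1 <= k < t.+1) (('X - (a k)%:P) * ('X - ((a k)^-1)%:P)) &
        map_poly (real_complex R) T =
          \prod_(1 <= k < t.+1) ('X - (a k + (a k)^-1)%:P)].

Definition Cpoly (R : realType) (n : nat) : {poly R} :=
  if odd n then
    \prod_(1 <= k < ((n - 1) %/ 2).+1)
       ('X - (2 * cos (2 * k%:R * pi / n%:R))%:P)
  else
    \prod_(1 <= k < ((n - 2) %/ 2).+1)
       ('X - (2 * cos (2 * k%:R * pi / n%:R))%:P).

(* All complex roots of D are real and lie in the open interval ]-2, 2[. *)
Definition roots_in_m2_2 (R : realType) (D : {poly int}) : Prop :=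
  forall z : R[i], root (map_poly intr D) z ->
    exists2 x : R, -2 < x < 2 & z = x%:C.

(* Main.v *)
(** Put y = x + 1/x and let P = C_n (x - 2) D (x - a) - 1 (with x^2 - 4 in place
    of x - 2 for even n).  For a large, P is a small perturbation of its
    first term: near each root of C_n (x - 2) D it has a root in ]-2, 2[,
    and it has one more root g > 2.  If P = F G over the integers with F(g) = 0,
    then G has all its roots in ]-2, 2[, so |G(a)| > 1 unless G is constant,
    whereas G(a) divides P(a) = -1; hence P is irreducible.
    Let al + 1/al = g.  A rational polynomial q can be written
    q(x) = A(y) + x B(y), and q(al) = 0 makes A^2 + y A B + B^2 vanish at g, hence
    at every root b of P; for |b| < 2 this form is definite, so A and B
    vanish at b and are multiples of P.  Thus x^t P(y) is the minimal polynomial of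
    al, and al is a Salem number.  Finally al^n - 1 is a unit because
    x^n - 1 = (x^e - 1) x^m C_n(y), with e = 1 or 2 according to the parity of n,
    (x^e - 1)^2 = x^e (y - 2), resp. x^e (y^2 - 4), and C_n (x - 2), resp.
    C_n (x^2 - 4), divides P + 1, which is 1 at g. *)

Require Import Defs.
From mathcomp Require Import all_boot all_order all_algebra all_field.
From mathcomp Require Import reals trigo.
From mathcomp Require Import complex.
From mathcomp Require Import ring lra zify.
Set Implicit Arguments.
Unset Strict Implicit.
Unset Printing Implicit Defensive.

Import Order.TTheory GRing.Theory Num.Theory.
Local Open Scope ring_scope.

(** * Lifting polynomials in y = x + 1/x to polynomials in x *)

(** Otherwise the nonzero polynomial p - q would have the roots 1, 2, ..., as many as its size.
    Identities involving 1/x can thus be checked by evaluation at nonzero x. *)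
Lemma poly_eq_on_units (F : numFieldType) (p q : {poly F}) :
  (forall x, x != 0 -> p.[x] = q.[x]) -> p = q.
Proof.
move=> epq; apply/eqP; rewrite -subr_eq0; apply/negPn/negP => nz.
pose rs := [seq i.+1%:R : F | i <- iota 0 (size (p - q))].
have: (size rs < size (p - q)%R)%N.
  apply: max_poly_roots => //.
    apply/allP => _ /mapP[i _ ->]; rewrite rootE hornerD hornerN epq ?subrr //.
    by rewrite pnatr_eq0.
  rewrite map_inj_uniq ?iota_uniq // => i j /eqP.
  by rewrite eqr_nat eqSS => /eqP.
by rewrite size_map size_iota ltnn.
Qed.

(** This is x^t p(x + 1/x) with the denominators cleared, meant for p of degree at most t; in this
    form it makes sense over any commutative ring and commutes with ring morphisms. *)
Definition recip_lift (A : comNzRingType) (t : nat) (p : {poly A}) : {poly A} :=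
  \sum_(i < t.+1) p`_i *: ('X^(t - i) * ('X^2 + 1) ^+ i).

Lemma horner_recip_lift (F : fieldType) t (p : {poly F}) x :
  (size p <= t.+1)%N -> x != 0 ->
  (recip_lift t p).[x] = x ^+ t * p.[x + x^-1].
Proof.
move=> sp x0; rewrite horner_sum (horner_coef_wide _ sp) mulr_sumr.
apply: eq_bigr => i _; rewrite !hornerE.
have -> : x + x^-1 = (x ^+ 2 + 1) / x by field.
have le_it : (i <= t)%N by rewrite -ltnS.
have -> : x ^+ t = x ^+ (t - i) * x ^+ i by rewrite -exprD subnK.
rewrite expr_div_n; have := expf_neq0 i x0.
by move: (x ^+ i) (x ^+ (t - i)) ((x ^+ 2 + 1) ^+ i) => u v w u0 /=; field.
Qed.

Lemma map_recip_lift (A B : comNzRingType) (f : {rmorphism A -> B}) t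
    (p : {poly A}) :
  map_poly f (recip_lift t p) = recip_lift t (map_poly f p).
Proof.
rewrite rmorph_sum; apply: eq_bigr => i _.
by rewrite /= map_polyZ rmorphM !rmorphXn /= rmorphD /= map_polyXn map_polyX rmorph1
  coef_map.
Qed.

(* Horner's scheme, using x * (A + x B) = - B + x (A + y B) for y = x + 1/x. *)
Lemma recip_decomposition (F : fieldType) (q : {poly F}) :
  exists A B : {poly F}, forall (E : fieldType) (f : {rmorphism F -> E}) (x : E),
    x != 0 -> (map_poly f q).[x] =
      (map_poly f A).[x + x^-1] + x * (map_poly f B).[x + x^-1].
Proof.
elim/poly_ind: q => [|q c [A [B IH]]].
  by exists 0, 0 => E f x _; rewrite !rmorph0 !horner0 mulr0 addr0.
exists (c%:P - B), (A + 'X * B) => E f x x0.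
rewrite !rmorphD /= !rmorphM /= rmorphN /= !map_polyX !map_polyC /= !hornerE IH //.
by field.
Qed.

(** * Chebyshev-like polynomials and the factorization of x^n - 1 *)

(* u_k = x^(k + e/2) - x^-(k + e/2) satisfies u_(k+2) = (x + 1/x) u_(k+1) - u_k;
   c = 1 for e = 1 and c = 0 for e = 2 make u_k = u_0 * cheb c k (x + 1/x). *)
Fixpoint cheb (c : int) (m : nat) : {poly int} :=
  match m with
  | 0 => 1
  | 1 => 'X + c%:P
  | (m2.+1 as m1).+1 => 'X * cheb c m1 - cheb c m2
  end.

Lemma cheb_monic_size c m : cheb c m \is monic /\ size (cheb c m) = m.+1.
Proof.
suff [] : (cheb c m \is monic /\ size (cheb c m) = m.+1) /\
  (cheb c m.+1 \is monic /\ size (cheb c m.+1) = m.+2) by [].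
elim: m => [|m [[mon0 sz0] [mon1 sz1]]].
  by rewrite monic1 size_poly1 /= monicXaddC size_XaddC.
split=> //; have szX : size ('X * cheb c m.+1) = m.+3.
  by rewrite mulrC size_mulX ?monic_neq0 // sz1.
have ltsz : (size (- cheb c m)%R < size ('X * cheb c m.+1)%R)%N.
  by rewrite size_polyN szX sz0.
change (cheb c m.+2) with ('X * cheb c m.+1 - cheb c m).
rewrite size_polyDl // szX; split=> //.
by rewrite monicE lead_coefDl // -monicE monicMr // monicX.
Qed.

Lemma cheb_recurrence (A : comNzRingType) (f : nat -> A) (c : int) (y : A) m :
  f 1%N = f 0%N * (y + c%:~R) ->
  (forall k, f k.+2 = y * f k.+1 - f k) ->
  f m = f 0%N * (map_poly intr (cheb c m)).[y].
Proof.
move=> f1 fSS; suff [] : f m = f 0%N * (map_poly intr (cheb c m)).[y] /\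
  f m.+1 = f 0%N * (map_poly intr (cheb c m.+1)).[y] by [].
elim: m => [|m [IH0 IH1]].
  rewrite /= rmorph1 hornerC mulr1 rmorphD /= map_polyX map_polyC /=.
  by rewrite hornerD hornerX hornerC.
split=> //; rewrite fSS IH1 IH0.
change (cheb c m.+2) with ('X * cheb c m.+1 - cheb c m).
rewrite rmorphB rmorphM /= map_polyX hornerD hornerN hornerM hornerX.
by rewrite mulrBr mulrCA.
Qed.

Lemma cheb_expB1 (F : fieldType) (x : F) (n : nat) : x != 0 -> (0 < n)%N ->
  let e := (2 - odd n)%N in
  let m := (n.-1)./2 in
  x ^+ n - 1 =
    (x ^+ e - 1) * (x ^+ m * (map_poly intr (cheb (odd n) m)).[x + x^-1]).
Proof.
move=> x0 n0 e m; have nE : n = (m.*2 + e)%N.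
  by rewrite /m /e; have := odd_double_half n; case: (odd n) => /=; lia.
(* In terms of the sequence u above, f k is x^(e/2) u_k, which avoids half-integral exponents. *)
pose f k := x ^- k * (x ^+ (k.*2 + e) - 1).
have xm0 : x ^+ m != 0 by rewrite expf_neq0.
have fSS k : f k.+2 = (x + x^-1) * f k.+1 - f k.
  rewrite /f !doubleS !addSn; move: (k.*2 + e)%N => d.
  rewrite !exprS; have := expf_neq0 k x0.
  by move: (x ^+ k) (x ^+ d) => u v u0; field; rewrite u0.
have f1 : f 1%N = f 0%N * (x + x^-1 + ((odd n)%:Z)%:~R).
  by rewrite /f /e; case: (odd n) => /=; field; rewrite x0 oner_neq0.
have := cheb_recurrence m f1 fSS; rewrite {1}/f -nE => fm.
have f0 : f 0%N = x ^+ e - 1 by rewrite /f expr0 invr1 mul1r.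
by rewrite mulrCA -f0 -fm mulVKf.
Qed.

(** * The roots of C_n and its integrality *)

Section CyclotomicTrace.
Variables (R : realType) (n : nat).
Hypothesis n_gt0 : (0 < n)%N.

Let e := (2 - odd n)%N.
Let m := (n.-1)./2.
Let nE : n = (m.*2 + e)%N.
Proof. by rewrite /m /e; have := odd_double_half n; case: (odd n) => /=; lia. Qed.
Let e_gt0 : (0 < e)%N. Proof. by rewrite /e; case: (odd n). Qed.

Definition Croots : seq R :=
  [seq 2 * cos (2 * k%:R * pi / n%:R) | k <- index_iota 1 m.+1].

(** With theta = 2 k pi / n, the first angle is theta, placed where cos is injective; the second is
    e theta / 2, whose sine must be nonzero in order to be cancelled. *)
Let angle_bounds k : (0 < k <= m)%N ->
  0 < 2 * k%:R * @pi R / n%:R < pi /\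
  0 < e%:R * (k%:R * @pi R / n%:R) < pi.
Proof.
move=> /andP[k0 km]; have pi0 := pi_gt0 R.
have n0R : 0 < n%:R :> R by rewrite ltr0n.
have lt1 : 2 * k%:R < n%:R :> R by rewrite -natrM ltr_nat nE; lia.
have lt2 : e%:R * k%:R < n%:R :> R.
  by rewrite -natrM ltr_nat nE /e; case: (odd n) => /=; lia.
have k0R : 0 < k%:R :> R by rewrite ltr0n.
have e0R : 0 < e%:R :> R by rewrite ltr0n.
rewrite !ltr_pdivrMr // !mulrA !ltr_pdivrMr // !divr_gt0 ?mulr_gt0 //.
by rewrite ![pi * _]mulrC !ltr_pM2r.
Qed.

Lemma Croots_bounds x : x \in Croots -> -2 < x < 2.
Proof.
case/mapP => k; rewrite mem_index_iota ltnS => /angle_bounds[/andP[h0 hpi] _] ->.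
set h := _ / _ in h0 hpi *.
have mem0 : (0 : R) \in `[0, pi] by rewrite in_itv /= lexx pi_ge0.
have mempi : @pi R \in `[0, pi] by rewrite in_itv /= lexx pi_ge0.
have memh : h \in `[0, pi] by rewrite in_itv /= !ltW.
have : cos pi < cos h < cos 0 by rewrite !ltr_cos ?h0 ?hpi.
rewrite cospi cos0 => /andP[h1 h2]; apply/andP; split; lra.
Qed.

Lemma Croots_uniq : uniq Croots.
Proof.
rewrite map_inj_in_uniq ?iota_uniq // => i j.
rewrite !mem_index_iota !ltnS => /angle_bounds[/andP[i0 ipi] _].
move=> /angle_bounds[/andP[j0 jpi] _] eqc.
have n0R : n%:R != 0 :> R by rewrite pnatr_eq0 -lt0n.
have pi0 := lt0r_neq0 (pi_gt0 R).
have : 2 * i%:R * pi / n%:R = 2 * j%:R * pi / n%:R :> R.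
  by apply: cos_inj; rewrite ?in_itv /= ?ltW //; lra.
by move=> /(divIf n0R)/(mulIf pi0)/mulfI; rewrite pnatr_eq0 => /(_ isT)/eqP;
  rewrite eqr_nat => /eqP.
Qed.

(* sin (m theta + e theta / 2) = sin (e theta / 2) C_n (2 cos theta) *)
Lemma Croots_root x : x \in Croots -> root (map_poly intr (cheb (odd n) m)) x.
Proof.
case/mapP => k; rewrite mem_index_iota ltnS => kP ->.
have [_ /andP[h0 hpi]] := angle_bounds kP.
set h := k%:R * pi / n%:R in h0 hpi.
have -> : 2 * k%:R * pi / n%:R = h *+ 2 :> R by rewrite /h mulr2n; ring.
pose f j := sin ((j.*2 + e)%:R * h).
have fSS j : f j.+2 = 2 * cos (h *+ 2) * f j.+1 - f j.
  rewrite /f; set u := (j.+1.*2 + e)%:R * h.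
  have -> : (j.+2.*2 + e)%:R * h = u + h *+ 2.
    by rewrite /u !doubleS !addSn -!natr1; ring.
  have -> : (j.*2 + e)%:R * h = u - h *+ 2.
    by rewrite /u !doubleS !addSn -!natr1; ring.
  by rewrite sinB sinD; ring.
have f1 : f 1%N = f 0%N * (2 * cos (h *+ 2) + ((odd n)%:Z)%:~R).
  rewrite /f /e; case: (odd n).
    rewrite -[(1.*2 + _)%N]/3%N -[(0.*2 + _)%N]/1%N.
    have -> : 3%:R * h = h *+ 2 + h by ring.
    by rewrite mul1r sinD sin_mulr2n cos_mulr2n /=; ring.
  rewrite -[(1.*2 + _)%N]/4%N -[(0.*2 + _)%N]/2%N.
  have -> : 4%:R * h = (h *+ 2) *+ 2 by ring.
  by rewrite sin_mulr2n (mulr_natl h 2) /=; ring.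
(* As 2 m + e = n, f m is sin (k pi) = 0, whereas f 0 = sin (e h) is positive; so the polynomial
   factor vanishes. *)
have := cheb_recurrence m f1 fSS; rewrite {1}/f -nE /h.
have -> : n%:R * (k%:R * pi / n%:R) = pi *+ k :> R.
  by field; rewrite pnatr_eq0 -lt0n.
have -> : sin (pi *+ k) = 0 :> R.
  by elim: k {kP h h0 hpi f fSS f1} => [|k IH]; rewrite ?sin0 // mulrS addrC sinDpi IH oppr0.
move=> /esym/eqP; rewrite mulf_eq0 => /orP[|//].
have /gt_eqF-> // : 0 < f 0%N by rewrite sin_gt0_pi ?h0.
Qed.

Lemma Cpoly_prod_Croots : Cpoly R n = \prod_(z <- Croots) ('X - z%:P).
Proof.
rewrite /Cpoly big_map.
have -> : ((n - 1) %/ 2)%N = (n.-1)./2 by rewrite divn2 subn1.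
case: ifP => // oddn; have -> // : ((n - 2) %/ 2)%N = (n.-1)./2.
by move: nE; rewrite /e /m oddn; lia.
Qed.

(** Both sides are monic of degree m and vanish at the m distinct entries of [Croots]. In particular
    C_n has integer coefficients. *)
Lemma Cpoly_cheb : Cpoly R n = map_poly intr (cheb (odd n) m).
Proof.
have [mon sz] := cheb_monic_size (odd n) m.
rewrite Cpoly_prod_Croots.
have monR : map_poly (intr : int -> R) (cheb (odd n) m) \is monic.
  by rewrite monic_map.
rewrite (@all_roots_prod_XsubC _ (map_poly intr (cheb (odd n) m)) Croots).
- by rewrite (monicP monR) scale1r.
- by rewrite size_map_poly_id0 ?(monicP mon) ?rmorph1 ?oner_neq0 // sz
    size_map size_iota subn1.
- by apply/allP => x /Croots_root.
by rewrite uniq_rootsE Croots_uniq.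
Qed.

End CyclotomicTrace.

(** * Minimal polynomials and products of reciprocal pairs *)

(** Division with remainder turns minimality of the size into divisibility, and monic polynomials
    dividing each other agree. This identifies the polynomial hidden in [conjugate] with an explicit
    one. *)
Lemma minpoly_unique (F : numFieldType) (x : F) (S1 S2 : {poly rat}) :
  is_minpoly S1 x -> is_minpoly S2 x -> S1 = S2.
Proof.
suff dvd p q : is_minpoly p x -> is_minpoly q x -> p %| q.
  move=> m1 m2; apply/eqP; rewrite -eqp_monic ?/eqp ?dvd //; first by case: m1.
  by case: m2.
move=> [monp rp minp] [_ rq _]; rewrite /dvdp; apply/negPn/negP => nz.
have rmod : root (map_poly ratr (q %% p)) x.
  move: rq; rewrite !rootE {1}(divp_eq q p) rmorphD rmorphM /= hornerD hornerM.
  by rewrite (rootP rp) mulr0 add0r.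
by have := minp _ nz rmod; rewrite leqNgt ltn_modp monic_neq0.
Qed.

Lemma prod_gt1 (R : numDomainType) (I : eqType) (s : seq I) (f : I -> R) :
  (forall i, i \in s -> 1 < f i) -> s != [::] -> 1 < \prod_(i <- s) f i.
Proof.
elim: s => // i s IH fs _; rewrite big_cons.
have fi : 1 < f i by rewrite fs ?mem_head.
have [-> | nz] := eqVneq s [::]; first by rewrite big_nil mulr1.
apply: lt_trans fi _; rewrite ltr_pMr ?(lt_trans _ (fs i _)) ?mem_head //.
by apply: IH => // j js; rewrite fs // inE js orbT.
Qed.

(** Each factor absorbs one power of x: x (x + 1/x - z - 1/z) = (x - z) (x - 1/z). *)
Lemma recip_lift_prod (F : numFieldType) (zs : seq F) :
  (forall z, z \in zs -> z != 0) ->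
  recip_lift (size zs) (\prod_(z <- zs) ('X - (z + z^-1)%:P)) =
    \prod_(z <- zs) (('X - z%:P) * ('X - z^-1%:P)).
Proof.
move=> zs0; apply: poly_eq_on_units => x x0.
rewrite horner_recip_lift ?size_prod_XsubC // !horner_prod.
elim: zs zs0 => [|z zs IH] zs0; first by rewrite !big_nil mulr1.
rewrite !big_cons -IH; last by move=> w wzs; rewrite zs0 // inE wzs orbT.
have z0 := zs0 _ (mem_head _ _); rewrite !hornerE /= exprS.
by move: (x ^+ _) (\prod_(_ <- _) _) => u v; field; apply/andP; split.
Qed.

Lemma size_map_intr (R : numDomainType) (p : {poly int}) :
  size (map_poly (intr : int -> R) p) = size p.
Proof. by rewrite size_map_inj_poly //; apply: intr_inj. Qed.

(** Only the term i = t lacks a factor x. For p monic of degree t the lift is therefore coprime to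
    x. *)
Lemma recip_lift0 (A : comNzRingType) t (p : {poly A}) :
  (recip_lift t p).[0] = p`_t.
Proof.
rewrite /recip_lift big_ord_recr /= subnn expr0 mul1r hornerD hornerZ.
rewrite horner_exp hornerD hornerXn hornerC expr0n add0r expr1n mulr1.
rewrite horner_sum big1 ?add0r // => i _.
by rewrite hornerZ hornerM hornerXn expr0n subn_eq0 leqNgt ltn_ord mul0r mulr0.
Qed.

(** * Irreducibility of P and minimality of x^t P(x + 1/x) *)

Section IntegralTracePolynomial.
Variables (R : realType) (P : {poly int}) (g : R) (bs : seq R) (a : int).
Hypothesis P_fact :
  map_poly intr P = ('X - g%:P) * \prod_(b <- bs) ('X - b%:P).
Hypothesis bs_bounds : forall b, b \in bs -> -2 < b < 2.
Hypothesis a_ge3 : 3 <= a.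
Hypothesis P_a : P.[a] = -1.

Let P_monic : P \is monic.
Proof.
have : map_poly (intr : int -> R) P \is monic.
  by rewrite P_fact monicMl ?monicXsubC // monic_prod_XsubC.
rewrite !monicE lead_coef_map_inj //; last exact: intr_inj.
by rewrite -[1]/(1%:~R) (inj_eq intr_inj).
Qed.

(* a - b > 1 for all b in bs, so a factor with all its roots among the b takes
   at a a value of modulus > 1, whereas it divides P(a) = -1. *)
Lemma cofactor_const (F r : {poly int}) :
  P = F * r -> root (map_poly intr F) g -> size r = 1%N.
Proof.
move=> PFr /factor_theorem[F1 F1E].
(* F already contains X - g, so cancelling it leaves r as a divisor of the product over [bs], hence
   a scalar times a subproduct. *)
have dvd : map_poly (intr : int -> R) r %| \prod_(b <- bs) ('X - b%:P).
  apply/dvdpP; exists F1.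
  have : ('X - g%:P) != 0 by rewrite polyXsubC_eq0.
  by move/mulfI; apply; rewrite -P_fact PFr rmorphM /= F1E; ring.
have /dvdp_prod_XsubC[m] := dvd.
set s := mask m bs => /eqpfP.
have -> : lead_coef (\prod_(i <- s) ('X - i%:P)) = 1.
  exact/monicP/monic_prod_XsubC.
rewrite divr1 => rE.
have unit_norm (u v : int) : u * v = 1 -> `|v%:~R| = 1 :> R.
  move=> uv; have : v \is a GRing.unit by apply/unitrPr; exists u; rewrite mulrC.
  by case/orP=> /eqP->; rewrite ?rmorphN1 ?normrN1 ?normr1.
have lead1 : `|lead_coef (map_poly intr r) : R| = 1.
  rewrite lead_coef_map_inj //; last exact: intr_inj.
  apply: (unit_norm (lead_coef F)); rewrite -lead_coefM -PFr; exact/monicP.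
have ra1 : `|(map_poly intr r).[a%:~R] : R| = 1.
  rewrite horner_map /=; apply: (unit_norm (- F.[a])).
  by rewrite mulNr -hornerM -PFr P_a opprK.
have : s == [::].
  apply/negPn/negP => s0.
  have : 1 < \prod_(b <- s) (a%:~R - b).
    apply: prod_gt1 => // b /mem_mask/bs_bounds/andP[_ b2].
    have : 3%:~R <= a%:~R :> R by rewrite ler_int.
    rewrite -[3%:~R]/(3%:R); lra.
  move/gt_eqF/negP; apply; apply/eqP; rewrite -[RHS]ra1 rE hornerZ normrM lead1.
  rewrite mul1r horner_prod ger0_norm.
    by apply: eq_bigr => b _; rewrite !hornerE.
  rewrite big_seq; apply: prodr_ge0 => b /mem_mask/bs_bounds/andP[_ b2].
  have : 3%:~R <= a%:~R :> R by rewrite ler_int.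
  rewrite !hornerE -[3%:~R]/(3%:R); lra.
move=> /eqP s0; rewrite -(size_map_intr R) rE s0.
rewrite big_nil size_scale ?size_poly1 //.
by rewrite -normr_eq0 lead1 oner_neq0.
Qed.

Let PQ : {poly rat} := map_poly intr P.

Let sizePQ : size PQ = (size bs).+2.
Proof.
rewrite size_map_intr -(size_map_intr R) P_fact.
by rewrite size_monicM ?monicXsubC ?monic_neq0 ?monic_prod_XsubC //
  size_XsubC size_prod_XsubC.
Qed.

(** By Gauss's lemma a rational factor of P comes from a factorization over the integers; g is a
    root of one of the two factors, and [cofactor_const] makes the other constant. *)
Lemma trace_poly_irreducible : irreducible_poly PQ.
Proof.
split=> [|q sq /dvdpP_rat_int[F [c c0 qE] [r PE]]]; first by rewrite sizePQ.
have : root (map_poly intr P) g by rewrite P_fact rootM root_XsubC eqxx.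
rewrite PE rmorphM rootM => /orP[rF|rr].
  have sr := cofactor_const PE rF.
  rewrite qE (eqp_trans (eqp_scale _ c0)) // /PQ PE rmorphM /= eqp_sym.
  have /size_poly1P[d d0 ->] : size (map_poly intr r : {poly rat}) == 1%N.
    by rewrite size_map_intr sr.
  by rewrite mulrC mul_polyC eqp_scale.
have sF : size F = 1%N by apply: (cofactor_const _ rr); rewrite mulrC.
by move: sq; rewrite qE size_scale // size_map_intr sF.
Qed.

(** An irreducible polynomial either divides A or is coprime to it, and the common root x excludes
    coprimality. *)
Lemma trace_poly_dvd (A : {poly rat}) (x : R) :
  root (map_poly intr P) x -> root (map_poly ratr A) x -> PQ %| A.
Proof.
move=> rP rA; apply/negPn; rewrite -(irreducible_poly_coprime A); last first.
  exact: trace_poly_irreducible.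
apply/negP; rewrite -(coprimep_map (ratr : {rmorphism rat -> R})).
have -> : map_poly ratr PQ = map_poly (intr : int -> R) P.
  by rewrite -map_poly_comp; apply: eq_map_poly => z; rewrite /= ratr_int.
by move/coprimep_root => /(_ _ rP)/negP; apply; rewrite (rootP rA).
Qed.

Variable al : R.
Hypothesis al_gt1 : 1 < al.
Hypothesis al_trace : al + al^-1 = g.
Hypothesis bs0 : bs != [::].

Let t := (size bs).+1.
Definition salem_poly : {poly rat} := recip_lift t PQ.

Lemma salem_poly_dvd (q : {poly rat}) :
  root (map_poly ratr q) al -> salem_poly %| q.
Proof.
move=> rq; have [A [B AB]] := recip_decomposition q.
have al0 : al != 0 by rewrite gt_eqF // (lt_trans ltr01).
have rPg : root (map_poly intr P) g by rewrite P_fact rootM root_XsubC eqxx.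
(* A single root b in ]-2, 2[ suffices, since by irreducibility a rational polynomial vanishing at b
   is a multiple of P. *)
have [b bbs] : exists b, b \in bs.
  by case: bs bs0 => // b s _; exists b; rewrite mem_head.
have rPb : root (map_poly intr P) b.
  by rewrite P_fact rootM root_prod_XsubC bbs orbT.
(* H is the norm (A + x B) (A + B/x) of q, written in y = x + 1/x. *)
pose H := A ^+ 2 + 'X * A * B + B ^+ 2.
have HE x : (map_poly ratr H).[x] = (map_poly ratr A).[x] ^+ 2
    + x * (map_poly ratr A).[x] * (map_poly ratr B).[x]
    + (map_poly ratr B).[x] ^+ 2 :> R.
  by rewrite !(rmorphD, rmorphM, rmorphXn) /= map_polyX !hornerE.
have rHg : root (map_poly ratr H) g.
  rewrite rootE HE; move: rq; rewrite rootE AB // al_trace.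
  rewrite addr_eq0 => /eqP->; rewrite -al_trace; apply/eqP; field.
  exact: al0.
have PH := trace_poly_dvd rPg rHg.
have rHb : root (map_poly ratr H) b.
  have /dvdpP[K ->] := PH; rewrite rmorphM rootM /=.
  have -> : map_poly ratr PQ = map_poly (intr : int -> R) P.
    by rewrite -map_poly_comp; apply: eq_map_poly => z; rewrite /= ratr_int.
  by rewrite rPb orbT.
have [rA rB] : root (map_poly ratr A) b /\ root (map_poly ratr B) b.
  move: rHb; rewrite !rootE HE; have /andP[b1 b2] := bs_bounds bbs.
  move: (_.[b]) (_.[b]) => v u /eqP uv0.
  have pos : 0 < 4 - b ^+ 2 by nra.
  (* Completing the square in 4 H(b) exhibits the form as definite for |b| < 2. *)
  have sum0 : (2 * u + b * v) ^+ 2 + (4 - b ^+ 2) * v ^+ 2 = 0.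
    have -> : (2 * u + b * v) ^+ 2 + (4 - b ^+ 2) * v ^+ 2 =
      4 * (u ^+ 2 + b * u * v + v ^+ 2) by ring.
    by rewrite uv0 mulr0.
  have /eqP := sum0; rewrite paddr_eq0 ?sqr_ge0 // ?(mulr_ge0 (ltW pos)) ?sqr_ge0 //.
  rewrite sqrf_eq0 mulf_eq0 (gt_eqF pos) /= sqrf_eq0 => /andP[/eqP u0 /eqP v0].
  by split; apply/eqP; move: u0; rewrite v0 mulr0 addr0 => /eqP;
    rewrite mulf_eq0 pnatr_eq0 => /eqP.
have /dvdpP[A1 A1E] := trace_poly_dvd rPb rA.
have /dvdpP[B1 B1E] := trace_poly_dvd rPb rB.
have sPQ : (size PQ <= t.+1)%N by rewrite sizePQ.
(* M bounds the degrees of both quotients, so x^M clears their denominators as x^t clears those of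
   P. *)
pose M := maxn (size A1) (size B1).
have qE : 'X^(t + M) * q = salem_poly * (recip_lift M A1 + 'X * recip_lift M B1).
  apply: poly_eq_on_units => x x0; rewrite !hornerE.
  have := AB _ (idfun : {rmorphism rat -> rat}) x x0.
  rewrite !map_poly_id // => ->.
  rewrite !horner_recip_lift //; try by rewrite leqW // leq_max leqnn ?orbT.
  by rewrite A1E B1E !hornerM exprD /=; ring.
have cop : coprimep salem_poly ('X^(t + M)).
  apply: coprimep_expr; rewrite coprimepX rootE recip_lift0.
  have -> : t = (size PQ).-1 by rewrite sizePQ.
  by rewrite -[_`_ _]/(lead_coef PQ) (monicP _) ?oner_neq0 // monic_map.
by rewrite -(Gauss_dvdpr _ cop) qE dvdp_mulr.
Qed.
End IntegralTracePolynomial.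

(** * From a trace polynomial to a Salem number *)

Local Open Scope complex_scope.

(** On the unit circle 1/z is the conjugate of z, so b must be twice the real part of z. *)
Lemma unit_circle_trace (R : realType) (b : R) : -2 < b < 2 ->
  exists z : R[i], `|z| = 1 /\ z + z^-1 = b%:C.
Proof.
move=> /andP[b1 b2]; pose s := Num.sqrt (1 - (b / 2) ^+ 2).
have s2 : s ^+ 2 = 1 - (b / 2) ^+ 2 by rewrite sqr_sqrtr //; nra.
exists ((b / 2) +i* s).
have norm1 : `|(b / 2) +i* s| = 1.
  by rewrite normc_def /= s2 addrC subrK sqrtr1.
split=> //; rewrite invc_norm norm1 expr1n invr1 mul1r.
by apply/eqP; rewrite eq_complex /= subrr eqxx andbT -splitr.
Qed.

Section SalemFromTracePolynomial.
Variables (R : realType) (P : {poly int}) (g : R) (bs : seq R) (a : int).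
Hypothesis P_fact :
  map_poly intr P = ('X - g%:P) * \prod_(b <- bs) ('X - b%:P).
Hypothesis bs_bounds : forall b, b \in bs -> -2 < b < 2.
Hypothesis a_ge3 : 3 <= a.
Hypothesis P_a : P.[a] = -1.
Variable al : R.
Hypothesis al_gt1 : 1 < al.
Hypothesis al_trace : al + al^-1 = g.
Hypothesis bs0 : bs != [::].

Let S := salem_poly P bs.
Let al0 : al != 0. Proof. by rewrite gt_eqF // (lt_trans ltr01). Qed.

Let traces_lift : exists2 zs : seq R[i],
  all (fun z => `|z| == 1) zs & [seq z + z^-1 | z <- zs] = [seq b%:C | b <- bs].
Proof.
elim: bs bs_bounds => [|b s IH] bounds; first by exists [::].
have [z [z1 zb]] := unit_circle_trace (bounds b (mem_head _ _)).
have [c cs | zs zs1 zsE] := IH; first by apply: bounds; rewrite inE cs orbT.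
by exists (z :: zs); rewrite /= ?z1 ?eqxx // zb zsE.
Qed.

Let ratr_intr (p : {poly int}) (F : numFieldType) :
  map_poly (ratr : rat -> F) (map_poly intr p) = map_poly intr p.
Proof. by rewrite -map_poly_comp; apply: eq_map_poly => z /=; rewrite ratr_int. Qed.

Let al_root : root (map_poly ratr S) al.
Proof.
rewrite map_recip_lift ratr_intr rootE horner_recip_lift //.
  by rewrite al_trace P_fact hornerM hornerXsubC subrr mul0r mulr0.
rewrite P_fact size_monicM ?monicXsubC ?monic_neq0 ?monic_prod_XsubC //.
by rewrite size_XsubC size_prod_XsubC.
Qed.

Let trace_fact (zs : seq R[i]) :
  [seq z + z^-1 | z <- zs] = [seq b%:C | b <- bs] ->
  map_poly intr P = \prod_(z <- al%:C :: zs) ('X - (z + z^-1)%:P) :> {poly R[i]}.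
Proof.
move=> zsE; have -> : map_poly intr P = map_poly (real_complex R) (map_poly intr P).
  by rewrite -map_poly_comp; apply: eq_map_poly => z /=; rewrite rmorph_int.
rewrite P_fact rmorphM rmorph_prod /= map_polyXsubC big_cons -fmorphV -rmorphD.
rewrite al_trace; congr (_ * _).
under eq_bigr do rewrite map_polyXsubC.
by rewrite -(big_map (real_complex R) xpredT (fun c => 'X - c%:P)) -zsE big_map.
Qed.

Let salem_fact (zs : seq R[i]) :
  all (fun z => `|z| == 1) zs ->
  [seq z + z^-1 | z <- zs] = [seq b%:C | b <- bs] ->
  map_poly ratr S =
    \prod_(z <- al%:C :: zs) (('X - z%:P) * ('X - z^-1%:P)) :> {poly R[i]}.
Proof.
move=> /allP zs1 zsE; rewrite map_recip_lift ratr_intr (trace_fact zsE).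
have -> : (size bs).+1 = size (al%:C :: zs).
  by rewrite /= -(size_map (real_complex R)) -zsE size_map.
apply: recip_lift_prod => z; rewrite inE => /orP[/eqP->|/zs1/eqP z1].
  by rewrite fmorph_eq0.
by rewrite -normr_eq0 z1 oner_neq0.
Qed.

Lemma salem_poly_monic : S \is monic.
Proof.
have [zs zs1 zsE] := traces_lift.
rewrite -(map_monic (ratr : {rmorphism rat -> R[i]})) (salem_fact zs1 zsE).
by apply: monic_prod => z _; rewrite monicMl ?monicXsubC.
Qed.

Lemma salem_poly_minpoly : is_minpoly S al.
Proof.
split=> [||q q0 rq]; [exact: salem_poly_monic | exact: al_root |].
apply: dvdp_leq => //.
exact: (salem_poly_dvd P_fact bs_bounds a_ge3 P_a al_gt1 al_trace bs0 rq).
Qed.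

Lemma salem_of_trace_poly : salem al.
Proof.
have [zs zs1 zsE] := traces_lift.
have SE := salem_fact zs1 zsE.
have conjE z : conjugate al z -> root (map_poly ratr S) z.
  by case=> S' /(minpoly_unique salem_poly_minpoly)<-.
split=> //.
- have SintE : S = map_poly intr (recip_lift (size bs).+1 P).
    by rewrite map_recip_lift.
  exists (recip_lift (size bs).+1 P).
    have := salem_poly_monic; rewrite SintE !monicE lead_coef_map_inj //.
      by rewrite -[1]/(1%:~R) (inj_eq intr_inj).
    exact: intr_inj.
  by have := al_root; rewrite SintE ratr_intr.
- move=> z /conjE; rewrite SE rootE horner_prod prodf_seq_eq0.
  move=> /hasP[w w_in /=]; rewrite hornerM !hornerXsubC mulf_eq0 !subr_eq0.
  move: w_in; rewrite inE => /orP[/eqP->|/(allP zs1)/eqP w1].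
    (* Of the real pair, al itself is excluded by assumption, and 1/al has modulus at most 1. *)
    move=> /orP[/eqP->|/eqP->]; first by case/eqP.
    move=> _; rewrite normfV normc_def /= expr0n addr0 sqrtr_sqr.
    rewrite ger0_norm ?(ltW (lt_trans ltr01 _)) // -fmorphV -(rmorph1 (real_complex R)).
    by rewrite lecR invf_le1 ?ltW // (lt_trans ltr01).
  by move=> /orP[/eqP->|/eqP->] _; rewrite ?normfV w1 ?invr1.
(* Since [bs] is nonempty, so is [zs], and its head is a conjugate on the unit circle. *)
case: zs zs1 zsE SE => [|z zs] /=.
  by move=> _ /esym/(congr1 size); rewrite size_map; case: (bs) bs0.
case/andP => /eqP z1 _ _ SE; exists z => //.
exists S; first exact: salem_poly_minpoly.
by rewrite SE !big_cons !rootM !root_XsubC eqxx !orbT.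
Qed.

Lemma trace_poly_of_salem : is_trace_poly al (map_poly intr P).
Proof.
have [zs zs1 zsE] := traces_lift.
have szs : size zs = size bs.
  by rewrite -(size_map (real_complex R)) -zsE size_map.
have nthE (F : R[i] -> {poly R[i]}) :
  \prod_(1 <= k < (size bs).+2) F (nth 0 (al%:C :: zs) k.-1) =
    \prod_(z <- al%:C :: zs) F z.
  by rewrite big_add1 /= [RHS](big_nth 0) /= szs.
(* Indices start at 1 in [is_trace_poly], hence the shift by [k.-1]; the default 0 is never reached
   for k from 1 to t. *)
exists S, (size bs).+1, (fun k => nth 0 (al%:C :: zs) k.-1); split.
- exact: salem_poly_minpoly.
- by case: (bs) bs0.
- case=> [|[|k]] // /andP[_ kle].
  by apply/eqP/(all_nthP 0 zs1); rewrite szs.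
- by rewrite (nthE (fun z => ('X - z%:P) * ('X - z^-1%:P))) (salem_fact zs1).
rewrite (nthE (fun z => 'X - (z + z^-1)%:P)) -(trace_fact zsE) -map_poly_comp.
by apply: eq_map_poly => z /=; rewrite rmorph_int.
Qed.

End SalemFromTracePolynomial.

Local Close Scope complex_scope.

(** * Roots of q (x - a) - 1 for large a *)

Lemma eventually_all (R : realDomainType) (T : eqType) (s : seq T)
    (p : T -> R -> Prop) :
  (forall x, x \in s -> exists a0, forall a, a0 <= a -> p x a) ->
  exists a0, forall a, a0 <= a -> forall x, x \in s -> p x a.
Proof.
elim: s => [|x s IH] ev; first by exists 0.
have [a1 a1P] := ev x (mem_head _ _).
have [|a2 a2P] := IH; first by move=> y ys; apply: ev; rewrite inE ys orbT.
exists (Num.max a1 a2) => a; rewrite ge_max => /andP[a1a a2a] y.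
by rewrite inE => /orP[/eqP-> | ys]; [apply: a1P | apply: a2P].
Qed.

Lemma seq_choice (T : eqType) (U : Type) (u0 : U) (s : seq T)
    (p : T -> U -> Prop) :
  (forall x, x \in s -> exists y, p x y) ->
  exists f : T -> U, forall x, x \in s -> p x (f x).
Proof.
elim: s => [|x s IH] ex; first by exists (fun=> u0).
have [y py] := ex x (mem_head _ _).
have [|f fP] := IH; first by move=> z zs; apply: ex; rewrite inE zs orbT.
exists (fun z => if z == x then y else f z) => z.
by rewrite inE; case: eqVneq => [-> //| _ /= zs]; apply: fP.
Qed.

Lemma exists_gap (R : realFieldType) (s : seq R) :
  exists2 d : R, 0 < d &
    forall x y, x \in s -> y \in s -> x != y -> 2 * d < `|x - y|.
Proof.
(* In terms of a = 1/d the gap condition reads 2 < a |x - y| and persists as a grows, so two uses of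
   [eventually_all] treat all pairs at once. *)
have [x xs|a0 a0P] := @eventually_all R R s (fun x a =>
    forall y, y \in s -> 1 <= a /\ (x != y -> 2 < a * `|x - y|)).
  apply: eventually_all => y ys.
  have [-> | neq] := eqVneq x y; first by exists 1 => a a1; split=> //; case/eqP.
  have d0 : 0 < `|x - y| by rewrite normr_gt0 subr_eq0.
  exists (1 + 2 / `|x - y|) => a le_a.
  have q0 : 0 < 2 / `|x - y| by rewrite divr_gt0.
  split=> [|_]; first by apply: le_trans le_a; rewrite lerDl ltW.
  by rewrite -ltr_pdivrMr //; apply: lt_le_trans le_a; rewrite ltrDr.
pose a := Num.max 1 a0.
have a_gt0 : 0 < a by rewrite lt_max ltr01.
exists a^-1 => [|x y xs ys neq]; first by rewrite invr_gt0.
have [|_ /(_ neq)] := a0P a _ x xs y ys; first by rewrite le_max lexx orbT.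
by rewrite ltr_pdivrMr // mulrC.
Qed.

Section Perturbation.
Variables (R : rcfType).
Implicit Types (q : {poly R}) (u v x a : R).

Lemma horner_perturb q a x : (q * ('X - a%:P) - 1).[x] = q.[x] * (x - a) - 1.
Proof. by rewrite hornerD hornerM hornerXsubC hornerN hornerC. Qed.

(** For large a the factor x - a is very negative, so q (x - a) - 1 is nonnegative at u and negative
    at v. Allowing q(v) = 0 lets v be an endpoint 2 or -2, which the root then avoids. *)
Lemma perturbed_root_between q u v : u <= 2 -> v <= 2 -> q.[u] < 0 -> 0 <= q.[v] ->
  exists a0, forall a, a0 <= a ->
    exists x, [/\ root (q * ('X - a%:P) - 1) x, x != v &
                  (u <= x <= v) || (v <= x <= u)].
Proof.
(* This bound gives a - u >= -1/q(u), hence q(u) (u - a) >= 1, and also a > 2 >= v. *)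
move=> u2 v2 qu qv; exists (2 - q.[u]^-1) => a le_a.
set p := _ - 1; have nqu : 0 < - q.[u] by rewrite oppr_gt0.
have inv0 : 0 < - q.[u]^-1 by rewrite -invrN invr_gt0.
have pu : 0 <= p.[u].
  rewrite horner_perturb.
  have : (- q.[u]) * (- q.[u]^-1) <= (- q.[u]) * (a - u).
    by rewrite ler_pM2l //; lra.
  rewrite mulrNN divff ?lt_eqF //; lra.
have pv : p.[v] < 0 by rewrite horner_perturb; nra.
have [uv | /ltW vu] := leP u v.
  have [||x xuv] := @poly_ivt _ (- p) u v; rewrite ?hornerN ?oppr_le0 ?oppr_ge0 //.
    by rewrite pu ltW.
  rewrite rootN => rx; exists x; rewrite rx xuv; split=> //.
  by apply: contraTneq rx => ->; rewrite rootE lt_eqF.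
have [||x xuv rx] := @poly_ivt _ p v u; rewrite // ?pu ?ltW //.
exists x; rewrite rx xuv orbT; split=> //.
by apply: contraTneq rx => ->; rewrite rootE lt_eqF.
Qed.

Variable rs : seq R.
Hypothesis rs_uniq : uniq rs.
Hypothesis rs_bounds : forall r, r \in rs -> -2 <= r <= 2.
Hypothesis rs_2 : 2 \in rs.
Hypothesis rs_N2 : -2 \in rs -> ~~ odd (size rs).

Let q : {poly R} := \prod_(r <- rs) ('X - r%:P).

Let horner_q x : q.[x] = \prod_(r <- rs) (x - r).
Proof. by rewrite horner_prod; under eq_bigr do rewrite hornerXsubC. Qed.

Let horner_q_rem r x : r \in rs -> q.[x] = (x - r) * \prod_(s <- rem r rs) (x - s).
Proof. by move=> rrs; rewrite horner_q (big_rem r). Qed.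

Let in_rem r s : (s \in rem r rs) -> s \in rs /\ r != s.
Proof. by rewrite mem_rem_uniq // inE eq_sym => /andP[]. Qed.

(** At an inner root r, q changes sign between r - d and r + d, and the point with q < 0 serves as
    u. At r = 2 only 2 - d is available, and there q < 0 because every other factor is positive. At
    r = -2 only -2 + d is available, where q has the sign of (-1)^(size rs - 1); this is the source
    of the parity condition [rs_N2]. *)
Lemma perturbed_root_near (d : R) (r : R) : r \in rs -> 0 < d ->
  (forall x y, x \in [:: -2, 2 & rs] -> y \in [:: -2, 2 & rs] -> x != y ->
     2 * d < `|x - y|) ->
  exists a0, forall a, a0 <= a ->
    exists x, [/\ root (q * ('X - a%:P) - 1) x, -2 < x < 2 & `|x - r| <= d].
Proof.
move=> rrs d0 gap.
have sub s : s \in rs -> s \in [:: -2, 2 & rs] 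
  by move=> srs; rewrite !in_cons srs !orbT.
have d_lt2 : d < 2.
  have neq : -2 != 2 :> R by rewrite lt_eqF //; lra.
  have := gap (-2) 2 _ _ neq; rewrite !in_cons !eqxx !orbT => /(_ isT isT).
  by rewrite ler0_norm; lra.
have qr : q.[r] = 0 by apply/rootP; rewrite root_prod_XsubC.
have /andP[r_ge r_le] := rs_bounds rrs.
have [r2 | r_neq2] := eqVneq r 2.
  have [|||| a0 a0P] := @perturbed_root_between q (r - d) r; rewrite ?qr ?r2 //.
  - by rewrite gerBl ltW.
  - rewrite (horner_q_rem _ rs_2) addrAC subrr add0r mulNr oppr_lt0 mulr_gt0 //.
    rewrite big_seq; apply: prodr_gt0 => s /in_rem[srs neq].
    have := gap _ _ (sub _ rs_2) (sub _ srs) neq.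
    have /andP[_ s2] := rs_bounds srs.
    by rewrite ger0_norm ?subr_ge0 //; lra.
  exists a0 => a /a0P[x [rx xn xb]]; exists x; rewrite rx r2 in xn xb *.
  have {xb} /andP[x1 x2] : 2 - d <= x <= 2.
    by case/orP: xb => // /andP[x1 x2]; apply/andP; split; lra.
  have xlt : x < 2 by rewrite lt_neqAle xn.
  split=> //; first by apply/andP; split; lra.
  by rewrite ler_distlC; apply/andP; split; lra.
have [rN2 | r_neqN2] := eqVneq r (-2).
  have N2rs : -2 \in rs by rewrite -rN2.
  have [|||| a0 a0P] := @perturbed_root_between q (r + d) r; rewrite ?qr ?rN2 //.
  - lra.
  - lra.
  - rewrite (horner_q_rem _ N2rs) addrAC subrr add0r.
    have -> : \prod_(s <- rem (-2) rs) (-2 + d - s) =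
        - \prod_(s <- rem (-2) rs) (s + 2 - d).
      have -> : - \prod_(s <- rem (-2) rs) (s + 2 - d) =
        (-1) ^+ size (rem (-2) rs) * \prod_(s <- rem (-2) rs) (s + 2 - d).
        have := rs_N2 N2rs; rewrite -signr_odd size_rem //.
        have : (0 < size rs)%N by case: (rs) rrs.
        by case: (size rs) => //= k _; case: (odd k) => //= _; rewrite expr1 mulN1r.
      elim: (rem _ _) => [|s l IH]; first by rewrite !big_nil mulr1.
      by rewrite !big_cons IH exprS; ring.
    rewrite mulrN oppr_lt0 mulr_gt0 //.
    rewrite big_seq; apply: prodr_gt0 => s /in_rem[srs neq].
    have := gap _ _ (sub _ N2rs) (sub _ srs) neq.
    have /andP[s2 _] := rs_bounds srs.
    by rewrite distrC ger0_norm ?subr_ge0 //; lra.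
  exists a0 => a /a0P[x [rx xn xb]]; exists x; rewrite rx rN2 in xn xb *.
  have {xb} /andP[x1 x2] : -2 <= x <= -2 + d.
    by case/orP: xb => // /andP[x1 x2]; apply/andP; split; lra.
  have xlt : -2 < x by rewrite lt_neqAle eq_sym xn.
  split=> //; first by apply/andP; split; lra.
  by rewrite ler_distlC; apply/andP; split; lra.
have up : r + d < 2.
  have := gap _ _ (sub _ rrs) (sub _ rs_2) r_neq2.
  by rewrite distrC ger0_norm ?subr_ge0 //; lra.
have lo : -2 < r - d.
  have := gap r (-2) (sub _ rrs) _ r_neqN2; rewrite !inE eqxx => /(_ isT).
  by rewrite ger0_norm; lra.
have neg : q.[r - d] * q.[r + d] < 0.
  rewrite !(horner_q_rem _ rrs) mulrACA -big_split /=.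
  have -> : (r - d - r) * (r + d - r) = - d ^+ 2 by ring.
  rewrite mulNr oppr_lt0 mulr_gt0 ?exprn_gt0 //.
  rewrite big_seq; apply: prodr_gt0 => s /in_rem[srs neq].
  have := gap _ _ (sub _ rrs) (sub _ srs) neq.
  rewrite ltr_normr => /orP[]; nra.
have sorted x : (r - d <= x <= r + d) || (r + d <= x <= r - d) ->
    r - d <= x <= r + d.
  by case/orP=> // /andP[x1 x2]; apply/andP; split; lra.
have finish x : r - d <= x <= r + d -> -2 < x < 2 /\ `|x - r| <= d.
  by case/andP=> x1 x2; rewrite ler_distlC; split; apply/andP; split; lra.
have [q1 | q1] := ltP q.[r - d] 0.
  have [|||| a0 a0P] := @perturbed_root_between q (r - d) (r + d) => //.
  - lra.
  - lra.
  - by rewrite ltW //; nra.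
  exists a0 => a /a0P[x [rx _ /sorted/finish[]]]; by exists x.
have [|||| a0 a0P] := @perturbed_root_between q (r + d) (r - d) => //.
- lra.
- lra.
- by nra.
by exists a0 => a /a0P[x [rx _]]; rewrite orbC => /sorted/finish[]; exists x.
Qed.

Lemma perturbed_roots :
  exists a0, forall a, a0 <= a -> exists (g : R) (bs : seq R),
    [/\ 2 < g, forall b, b \in bs -> -2 < b < 2, size bs = size rs &
        q * ('X - a%:P) - 1 = ('X - g%:P) * \prod_(b <- bs) ('X - b%:P)].
Proof.
(* Including -2, which need not belong to [rs], keeps r - d above -2 for every inner root r. *)
have [d d0 gap] := exists_gap [:: -2, 2 & rs].
have [|a0 a0P] := @eventually_all R R rs (fun r a =>
    exists x, [/\ root (q * ('X - a%:P) - 1) x, -2 < x < 2 & `|x - r| <= d]).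
  by move=> r rrs; apply: perturbed_root_near.
exists (Num.max 2 a0) => a; rewrite ge_max => /andP[a2 /a0P/(seq_choice 0)[f fP]].
set p := _ - 1; pose bs := map f rs.
have bsP b : b \in bs -> root p b /\ -2 < b < 2.
  by case/mapP=> r /fP[] ? ? _ ->.
have [g g2 rg] : exists2 g, 2 < g & root p g.
  have q2 : q.[2] = 0 by apply/rootP; rewrite root_prod_XsubC.
  have p2 : p.[2] = -1 by rewrite horner_perturb q2 mul0r add0r.
  (* The value is -1 at 2, and at a + 1 it is q(a + 1) - 1 >= 0 because each factor a + 1 - r is at
     least 1. *)
  have [||x /andP[x2 _] rx] := @poly_ivt _ p 2 (a + 1).
  - lra.
  - rewrite p2 lerN10 /= horner_perturb addrAC subrr add0r mulr1 subr_ge0 horner_q.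
    rewrite big_seq; elim/big_ind: _ => [//|x y x1 y1|r /rs_bounds/andP[_ r2]].
      nra.
    lra.
  exists x => //; rewrite lt_neqAle x2 andbT; apply: contraTneq rx => <-.
  by rewrite rootE p2 oppr_eq0 oner_eq0.
exists g, bs; split=> // [b /bsP[]//||]; first by rewrite size_map.
have q_monic : q \is monic by apply: monic_prod_XsubC.
have sq : size (q * ('X - a%:P)) = (size rs).+2.
  by rewrite size_Mmonic ?monicXsubC ?monic_neq0 // size_XsubC size_prod_XsubC addn2.
have sp : size p = (size rs).+2.
  by rewrite size_polyDl sq // size_polyN size_poly1.
have p_monic : p \is monic.
  rewrite monicE lead_coefDl ?sq ?size_polyN ?size_poly1 //.
  by rewrite -monicE monicMl ?monicXsubC.
rewrite (@all_roots_prod_XsubC _ p (g :: bs)) ?(monicP p_monic) ?scale1r ?big_cons //.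
- by rewrite /= size_map sp.
- by rewrite /= rg; apply/allP => b /bsP[].
rewrite uniq_rootsE /=; apply/andP; split.
  by apply/negP => /bsP[_ /andP[_]]; rewrite ltNge ltW.
(* A root shared by r and s would give |r - s| <= 2 d, against the gap. *)
rewrite map_inj_in_uniq // => r s rrs srs frs; apply/eqP/negPn/negP => neq.
have := gap r s _ _ neq; rewrite !inE rrs srs !orbT => /(_ isT isT).
have [_ _ d1] := fP _ rrs; have [_ _ d2] := fP _ srs; rewrite frs in d1.
have : `|r - s| <= `|f s - r| + `|f s - s|.
  by rewrite [in leRHS]distrC (le_trans _ (ler_normD _ _)) // addrA subrK.
lra.
Qed.
End Perturbation.

(** * Algebraic integers, real factorization of D, and solving x + 1/x = g *)

Section AlgebraicIntegers.
Variable F : fieldType.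
Implicit Types x y : F.

Lemma alg_int_intr (z : int) : alg_int (z%:~R : F).
Proof. exact: (integral_id (intr : {rmorphism int -> F})). Qed.

Lemma alg_intB x y : alg_int x -> alg_int y -> alg_int (x - y).
Proof. exact: (@integral_sub _ _ (intr : {rmorphism int -> F})). Qed.

Lemma alg_intM x y : alg_int x -> alg_int y -> alg_int (x * y).
Proof. exact: (@integral_mul _ _ (intr : {rmorphism int -> F})). Qed.

Lemma alg_intX x k : alg_int x -> alg_int (x ^+ k).
Proof.
move=> ix; elim: k => [|k IH]; last by rewrite exprS; apply: alg_intM.
exact: (alg_int_intr 1).
Qed.

Lemma alg_int_horner (p : {poly int}) x : alg_int x -> alg_int (map_poly intr p).[x].
Proof.
apply: (@integral_horner _ _ (intr : {rmorphism int -> F})).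
apply/integral_poly => i; rewrite coef_map; exact: alg_int_intr.
Qed.
End AlgebraicIntegers.

(** The complex factorization descends to the reals by taking real parts, as all roots are real;
    separability makes the roots distinct. *)
Lemma split_real_roots (R : realType) (D : {poly int}) :
  D \is monic -> separable_poly (map_poly (intr : int -> rat) D) ->
  roots_in_m2_2 R D ->
  exists ds : seq R, [/\ uniq ds, forall d, d \in ds -> -2 < d < 2 &
    map_poly intr D = \prod_(d <- ds) ('X - d%:P)].
Proof.
move=> Dmon Dsep Droots.
have [zs DE] := closed_field_poly_normal (map_poly (intr : int -> R[i]%C) D).
have Rmon (A : nzRingType) : map_poly (intr : int -> A) D \is monic by apply: monic_map.
rewrite (monicP (Rmon _)) scale1r in DE.
have zsP z : z \in zs -> exists2 x : R, -2 < x < 2 & z = x%:C%C.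
  by move=> z_in; apply: Droots; rewrite DE root_prod_XsubC.
pose ds := [seq complex.Re z | z <- zs].
have DRE : map_poly (intr : int -> R) D = \prod_(d <- ds) ('X - d%:P).
  apply: (map_poly_inj (real_complex R)); rewrite -map_poly_comp rmorph_prod.
  transitivity (map_poly (intr : int -> R[i]%C) D).
    by apply: eq_map_poly => z; rewrite /= rmorph_int.
  rewrite DE big_map big_seq [RHS]big_seq; apply: eq_bigr => z /zsP[x _ ->] /=.
  by rewrite map_polyXsubC.
exists ds; split=> //.
  rewrite -separable_prod_XsubC -DRE.
  have -> : map_poly (intr : int -> R) D = map_poly ratr (map_poly (intr : int -> rat) D).
    by rewrite -map_poly_comp; apply: eq_map_poly => z; rewrite /= ratr_int.
  by rewrite separable_map.
by move=> d /mapP[z /zsP[x xb ->] ->].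
Qed.

Lemma exists_add_inv (R : rcfType) (g : R) : 2 < g ->
  exists2 al : R, 1 < al & al + al^-1 = g.
Proof.
(* The witness is the larger root of x^2 - g x + 1, whose roots have product 1. *)
move=> g2; pose s := Num.sqrt (g ^+ 2 - 4).
have s2 : s ^+ 2 = g ^+ 2 - 4 by rewrite sqr_sqrtr //; nra.
have s0 : 0 <= s by apply: sqrtr_ge0.
have al1 : 1 < (g + s) / 2 by lra.
exists ((g + s) / 2) => //.
have al0 : (g + s) / 2 != 0 by rewrite gt_eqF // (lt_trans ltr01).
have -> : ((g + s) / 2)^-1 = (g - s) / 2.
  apply: (mulfI al0); rewrite divff //.
  have -> : (g + s) / 2 * ((g - s) / 2) = (g ^+ 2 - s ^+ 2) / 4 by field.
  by rewrite s2; field.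
by field.
Qed.

(** * Both parities at once, with E = x - 2 or x^2 - 4 *)

(* With y = al + 1/al and e = 1 or 2, al ^ n - 1 = (al ^ e - 1) al ^ m C_n(y) while
   (al ^ e - 1) ^ 2 = al ^ e E(y), where E C_n D (x - a) takes the value 1 at y;
   so (al ^ n - 1) (al ^ e - 1) D(y) (y - a) = al ^ (m + e). *)
Lemma salem_family (R : realType) (n : nat) (D E : {poly int}) (er : seq R) :
  let e := (2 - odd n)%N in
  let t := ((n.-1)./2 + size er + (size D).-1).+1 in
  (0 < n)%N ->
  D \is monic ->
  separable_poly (map_poly (intr : int -> rat) D) ->
  roots_in_m2_2 R D ->
  coprimep (map_poly (intr : int -> R) D) (Cpoly R n) ->
  map_poly intr E = \prod_(r <- er) ('X - r%:P) ->
  uniq er -> 2 \in er -> (forall r, r \in er -> r = 2 \/ r = -2) ->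
  (-2 \in er -> odd t) ->
  (forall x : R, x != 0 ->
    (x ^+ e - 1) ^+ 2 = x ^+ e * (map_poly intr E).[x + x^-1]) ->
  exists a0 : int, forall a : int, a0 <= a ->
    let T : {poly R} :=
      Cpoly R n * map_poly intr E * map_poly intr D * ('X - (a%:~R)%:P) - 1 in
    size T = t.+1 /\
    exists alpha : R,
      [/\ salem alpha, is_trace_poly alpha T & alg_unit (alpha ^+ n - 1)].
Proof.
move=> e t n0 Dmon Dsep Droots cop EE er_uniq er2 erP er_odd Esq.
have [ds [ds_uniq ds_bounds DE]] := split_real_roots Dmon Dsep Droots.
pose rs := Croots R n ++ er ++ ds.
have CE := Cpoly_prod_Croots R n0.
have in_er2 r : r \in er -> ~~ (-2 < r < 2).
  by case/erP=> ->; rewrite ltxx ?andbF.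
have rs_uniq : uniq rs.
  rewrite /rs !cat_uniq Croots_uniq // er_uniq ds_uniq andbT /=.
  rewrite has_cat negb_or; apply/andP; split; [apply/andP; split|].
  - by apply/hasPn => r /in_er2; apply: contra => /(Croots_bounds n0).
  - apply/hasPn => r rds; apply/negP => rC.
    have := coprimep_root cop (_ : root _ r).
    rewrite DE root_prod_XsubC => /(_ rds).
    by rewrite CE -rootE root_prod_XsubC rC.
  - by apply/hasPn => r /ds_bounds rb; apply/negP => /in_er2; rewrite rb.
have rs_bounds r : r \in rs -> -2 <= r <= 2.
  rewrite !mem_cat => /or3P[/(Croots_bounds n0)|/erP|/ds_bounds].
  - by case/andP=> ? ?; rewrite !ltW.
  - by case=> ->; apply/andP; split; lra.
  - by case/andP=> ? ?; rewrite !ltW.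
have rs2 : 2 \in rs by rewrite !mem_cat er2 orbT.
have size_rs : (size rs).+1 = t.
  rewrite /rs !size_cat size_map size_iota subn1 addnA /t.
  congr (_ + _).+1.
  have <- : size (map_poly (intr : int -> R) D) = size D by apply: size_map_intr.
  by rewrite DE size_prod_XsubC.
have rsN2 : -2 \in rs -> ~~ odd (size rs).
  have N2 : ((-2 : R) < -2 < 2) = false by rewrite ltxx.
  rewrite !mem_cat => /or3P[/(Croots_bounds n0)||/ds_bounds]; rewrite ?N2 //.
  (* The root g accounts for the one degree missing from [rs], so t odd means an even number of
     entries. *)
  by move/er_odd; rewrite -size_rs.
have rsE : Cpoly R n * map_poly intr E * map_poly intr D =
    \prod_(r <- rs) ('X - r%:P).
  by rewrite CE EE DE /rs !big_cat /= mulrA.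
have [a1 a1P] := perturbed_roots rs_uniq rs_bounds rs2 rsN2.
(* The 3 ensures a - b > 1 for all b < 2, as irreducibility requires; the ceiling makes the real
   threshold an integer. *)
exists (Num.max 3 (Num.ceil a1)) => a; rewrite ge_max => /andP[a3 aa1] T.
have [|g [bs [g2 bs_bounds sbs]]] := a1P a%:~R.
  by rewrite (le_trans (ceil_ge _)) // ler_int.
rewrite -rsE -/T => TE.
pose P := cheb (odd n) (n.-1)./2 * E * D * ('X - a%:P) - 1.
have TP : T = map_poly intr P.
  by rewrite rmorphB !rmorphM /= map_polyXsubC rmorph1 -Cpoly_cheb.
have P_a : P.[a] = -1.
  by rewrite !hornerE subrr mulr0 add0r.
have bs0 : bs != [::].
  by rewrite -size_eq0 sbs size_eq0; apply: contraTneq rs2 => ->.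
have [al al1 alg] := exists_add_inv g2.
have al0 : al != 0 by rewrite gt_eqF // (lt_trans ltr01).
have P_fact : map_poly intr P = ('X - g%:P) * \prod_(b <- bs) ('X - b%:P).
  by rewrite -TP.
split.
  by rewrite TE size_monicM ?monicXsubC ?monic_neq0 ?monic_prod_XsubC //
    size_XsubC size_prod_XsubC sbs -size_rs.
have sal := salem_of_trace_poly P_fact bs_bounds a3 P_a al1 alg bs0.
exists al; split=> //.
  rewrite TP; exact: (trace_poly_of_salem P_fact bs_bounds a3 P_a al1 alg bs0).
have al_int : alg_int al by case: sal.
have rTg : root T g by rewrite TE rootM root_XsubC eqxx.
have g_int : alg_int g.
  exists P; last by rewrite -TP.
  have : map_poly (intr : int -> R) P \is monic.
    by rewrite P_fact monicMl ?monicXsubC // monic_prod_XsubC.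
  rewrite !monicE lead_coef_map_inj //; last exact: intr_inj.
  by rewrite -[1]/(1%:~R) (inj_eq intr_inj).
have alV_int : alg_int al^-1.
  have -> : al^-1 = g - al by rewrite -alg addrC addKr.
  exact: alg_intB.
pose w := (map_poly intr D).[g] * (g - a%:~R).
(* This is the inverse of al^n - 1, built only from integers, al, 1/al = g - al and g, hence an
   algebraic integer. *)
pose v := (al ^+ e - 1) * w * al^-1 ^+ (e + (n.-1)./2).
have uv1 : (al ^+ n - 1) * v = 1.
  rewrite (cheb_expB1 al0 n0) -/e -Cpoly_cheb // alg /v.
  have := Esq al al0; rewrite alg => Eal.
  (* T(g) = 0 says exactly that the product before subtracting 1 takes the value 1 at g. *)
  have Tg : (Cpoly R n).[g] * (map_poly intr E).[g] * w = 1.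
    move: rTg; rewrite rootE hornerD hornerN hornerC !hornerM hornerXsubC.
    by rewrite subr_eq0 -!mulrA => /eqP.
  transitivity ((al ^+ e - 1) ^+ 2 * al ^+ (n.-1)./2 * (Cpoly R n).[g] * w *
    al^-1 ^+ (e + (n.-1)./2)); first by ring.
  rewrite Eal exprVn exprD.
  transitivity ((Cpoly R n).[g] * (map_poly intr E).[g] * w); last exact: Tg.
  have := expf_neq0 e al0; have := expf_neq0 (n.-1)./2 al0.
  by move: (al ^+ e) (al ^+ _) => x y x0 y0; field; rewrite x0 y0.
have u0 : al ^+ n - 1 != 0.
  by apply: contra_eq_neq uv1 => ->; rewrite mul0r eq_sym oner_neq0.
have int1 : alg_int (1 : R) by apply: (alg_int_intr _ 1).
split=> //; first by apply: alg_intB => //; apply: alg_intX.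
have -> : (al ^+ n - 1)^-1 = v by apply: (mulfI u0); rewrite uv1 divff.
apply: alg_intM; last exact: alg_intX.
apply: alg_intM; first by apply: alg_intB => //; apply: alg_intX.
apply: alg_intM; first exact: alg_int_horner.
by apply: alg_intB => //; apply: alg_int_intr.
Qed.

Unset Implicit Arguments.

Theorem theorem3 (R : realType) :
  (forall (n t : nat) (D : {poly int}),
     (1 <= n)%N -> odd n ->
     ((n + 3) %/ 2 <= t)%N ->
     D \is monic ->
     separable_poly (map_poly (intr : int -> rat) D) ->
     size D = (t - (n + 3) %/ 2).+1 ->
     roots_in_m2_2 R D ->
     coprimep (map_poly (intr : int -> R) D) (Cpoly R n) ->
     exists a0 : int, forall a : int, a0 <= a ->
       let T : {poly R} :=
         Cpoly R n * ('X - 2%:P) * map_poly (intr : int -> R) D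
           * ('X - (a%:~R)%:P) - 1 in
       size T = t.+1 /\
       exists alpha : R,
         [/\ salem alpha, is_trace_poly alpha T & alg_unit (alpha ^+ n - 1)])
  /\
  (forall (n t : nat) (D : {poly int}),
     (2 <= n)%N -> ~~ odd n ->
     odd t -> ((n + 4) %/ 2 <= t)%N ->
     D \is monic ->
     separable_poly (map_poly (intr : int -> rat) D) ->
     size D = (t - (n + 4) %/ 2).+1 ->
     roots_in_m2_2 R D ->
     coprimep (map_poly (intr : int -> R) D) (Cpoly R n) ->
     exists a0 : int, forall a : int, a0 <= a ->
       let T : {poly R} :=
         Cpoly R n * ('X ^+ 2 - 4%:P) * map_poly (intr : int -> R) D
           * ('X - (a%:~R)%:P) - 1 in
       size T = t.+1 /\
       exists alpha : R,
         [/\ salem alpha, is_trace_poly alpha T & alg_unit (alpha ^+ n - 1)]).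
Proof.
split=> n t D n0 oddn.
- move=> tn Dmon Dsep sD Droots cop.
  (* Here e = 1 and (x - 1)^2 = x (x + 1/x - 2). *)
  have [|||||||a0 a0P] := @salem_family R n D ('X - 2%:P) [:: 2] _ Dmon Dsep Droots cop.
  + exact: n0.
  + by rewrite map_polyXsubC big_seq1.
  + by [].
  + by rewrite mem_head.
  + by move=> r; rewrite inE => /eqP; left.
  + by rewrite inE eq_sym -addr_eq0 -natrD pnatr_eq0.
  + by move=> x x0; rewrite oddn map_polyXsubC !hornerE /=; field; exact: x0.
  exists a0 => a /a0P; rewrite map_polyXsubC /= sD /=.
  by have -> : ((n.-1)./2 + 1 + (t - (n + 3) %/ 2)).+1 = t by lia.
- move=> oddt tn Dmon Dsep sD Droots cop.
  have tE : ((n.-1)./2 + 2 + (size D).-1).+1 = t.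
    by rewrite sD /=; move: oddn n0 tn; clear; lia.
  have EE : map_poly (intr : int -> R) ('X ^+ 2 - 4%:P) = 'X ^+ 2 - 4%:P.
    by rewrite rmorphB rmorphXn /= map_polyX map_polyC.
  (* Here e = 2 and (x^2 - 1)^2 = x^2 ((x + 1/x)^2 - 4); the root -2 of E makes the oddness of t
     necessary for [salem_family]. *)
  have [|||||||a0 a0P] :=
      @salem_family R n D ('X ^+ 2 - 4%:P) [:: 2; -2] _ Dmon Dsep Droots cop.
  + exact: ltnW.
  + rewrite EE big_cons big_seq1 polyCN opprK -subr_sqr -polyC_exp.
    by rewrite -natrX.
  + by rewrite /= inE -addr_eq0 -natrD pnatr_eq0.
  + by rewrite mem_head.
  + by move=> r; rewrite !inE => /orP[]/eqP; [left | right].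
  + by move=> _; rewrite tE.
  + move=> x x0; rewrite (negbTE oddn) EE !hornerE /=; field; exact: x0.
  exists a0 => a /a0P; rewrite EE /=.
  by have -> : ((n.-1)./2 + 2 + (size D).-1).+1 = t by exact: tE.
Qed.
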